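(* Let $p$ be any prime and let $G=\mathbf{Z}_{p}\oplus\mathbf{Z}_{p^{2}}$. Then \[ \theta(G,d)= \begin{cases} p^{3}(p-2)^{2} & \text{for } d=1;\\ p(2p^{3}-4p^{2}+1) & \text{for } d=p;\\ p^{3}-p-1 & \text{for } d=p^{2};\\ 1 & \text{for } d=p^{3}. \end{cases} \]
   Context: $\mathbf{Z}_{n}$ denotes the (additive) group of integers modulo $n$. For a finite group $G$ and $f\in\operatorname{Aut}G$, let $\Omega_{G}(f)=\{g\in G: f(g)=g\}$ be the fixed point subgroup of $f$. For a divisor $d$ of $|G|$, $\theta(G,d)=|\{f\in\operatorname{Aut}G: |\Omega_{G}(f)|=d\}|$ is the number of automorphisms of $G$ fixing exactly $d$ elements of $G$. *)

(* Defs.v *)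
From mathcomp Require Import all_boot all_order all_algebra all_fingroup all_solvable.

Set Implicit Arguments.
Unset Strict Implicit.
Unset Printing Implicit Defensive.

Local Open Scope group_scope.

Definition Omega (gT : finGroupType) (G : {group gT}) (f : {perm gT}) :
  {set gT} := [set g in G | f g == g].

Definition theta (gT : finGroupType) (G : {group gT}) (d : nat) : nat :=
  #|[set f in Aut G | #|Omega G f| == d]|.

(* For [p] prime, ['Z_p] and ['Z_(p ^ 2)] are the integers modulo [p] and
   modulo [p ^ 2], whose MathComp group law is addition; the product type
   carries the componentwise law. *)
Definition Zp_oplus_Zp2 (p : nat) : {group 'Z_p * 'Z_(p ^ 2)} :=
  [set: 'Z_p * 'Z_(p ^ 2)]%G.

(* Main.v *)
(* An endomorphism of Z_p + Z_{p^2} is given by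
     f (x, y) = (a x + b y, p c x + d y),  a, b, c mod p and d mod p^2,
   and it is bijective iff p divides neither a nor d.  If d <> 1 mod p, the
   fixed points are determined by their coordinate x, subject to
   (a - 1) x = 0.  If d = 1 + p e, they form the preimage, under reduction of y
   modulo p, of the kernel of [[a - 1, b], [c, e]], so there are
   p^(3 - rank) of them, and what remains is to count matrices of each rank
   with upper left entry different from -1. *)
Require Import Defs.
From mathcomp Require Import all_boot all_order all_algebra all_fingroup all_solvable.
From mathcomp Require Import ring zify.

Set Implicit Arguments.
Unset Strict Implicit.
Unset Printing Implicit Defensive.

Import GRing.Theory.

Local Open Scope ring_scope.

Lemma unit_mulr_eq0 (R : unitRingType) (x y : R) :
  x \is a GRing.unit -> (x * y == 0) = (y == 0).
Proof. by move=> /mulrI/mulrI_eq0. Qed.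

(** * Reduction of Z/p^2 modulo p, and Z/p embedded as the multiples of p *)

Section ReductionModP.

Variables (p : nat) (p_pr : prime p).

Let p_gt0 : (0 < p)%N := prime_gt0 p_pr.
Let p_gt1 : (1 < p)%N := prime_gt1 p_pr.
Let p2_gt1 : (1 < p ^ 2)%N.
Proof. by rewrite (ltn_exp2l 0). Qed.

Definition red (y : 'Z_(p ^ 2)) : 'Z_p := (y : nat)%:R.
Definition lift (x : 'Z_p) : 'Z_(p ^ 2) := (p * x)%:R.
(** Inverts [lift] on the multiples of p; on other elements the rounded quotient has no algebraic
    meaning. *)
Definition unlift (y : 'Z_(p ^ 2)) : 'Z_p := (y %/ p)%:R.

Lemma card_Z_p : #|'Z_p| = p.
Proof. by rewrite card_ord Zp_cast. Qed.

Lemma natr_val_Zp (n : nat) (x : 'Z_n) : (x : nat)%:R = x.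
Proof. exact: natr_Zp. Qed.

Lemma red_nat n : red n%:R = n%:R.
Proof.
rewrite /red val_Zp_nat // [in RHS](divn_eq n (p ^ 2)) natrD natrM natrX.
by rewrite pchar_Zp // expr0n mulr0 add0r.
Qed.

Lemma redD y z : red (y + z) = red y + red z.
Proof. by rewrite -(natr_val_Zp y) -(natr_val_Zp z) -natrD !red_nat natrD. Qed.

Lemma redM y z : red (y * z) = red y * red z.
Proof. by rewrite -(natr_val_Zp y) -(natr_val_Zp z) -natrM !red_nat natrM. Qed.

Lemma red0 : red 0 = 0. Proof. exact: (red_nat 0). Qed.
Lemma red1 : red 1 = 1. Proof. exact: (red_nat 1). Qed.

Lemma redN y : red (- y) = - red y.
Proof. by apply/eqP; rewrite -addr_eq0 -redD addNr red0. Qed.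

Lemma lift_nat n : lift n%:R = (p * n)%:R.
Proof.
rewrite /lift val_Zp_nat // [in RHS](divn_eq n p) mulnDr mulnCA mulnn natrD.
by rewrite [(_ * p ^ 2)%:R]natrM pchar_Zp // mulr0 add0r.
Qed.

(** Multiplication by p forgets all but the residue modulo p, so products with multiples of p can be
    computed in Z/p. *)
Lemma liftM x y : lift (x * red y) = lift x * y.
Proof.
rewrite -(natr_val_Zp y) -(natr_val_Zp x) red_nat -natrM !lift_nat -natrM.
by rewrite mulnA.
Qed.

Lemma liftD x y : lift (x + y) = lift x + lift y.
Proof.
rewrite -(natr_val_Zp y) -(natr_val_Zp x) -natrD !lift_nat -natrD.
by rewrite mulnDr.
Qed.

Lemma lift0 : lift 0 = 0.
Proof. by rewrite (lift_nat 0) muln0. Qed.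

Lemma red_lift x : red (lift x) = 0.
Proof. by rewrite /lift red_nat natrM pchar_Zp // mul0r. Qed.

Lemma liftK : cancel lift unlift.
Proof.
move=> x; rewrite /unlift /lift val_Zp_nat // modn_small ?mulKn ?natr_val_Zp //.
by rewrite -mulnn ltn_pmul2l // -[ltnRHS](Zp_cast p_gt1).
Qed.

Lemma unliftK y : red y = 0 -> lift (unlift y) = y.
Proof.
move=> /(congr1 val) /=; rewrite /red val_Zp_nat // => y0.
by rewrite /unlift lift_nat mulnC divnK ?natr_val_Zp // /dvdn y0.
Qed.

Lemma unit_Zp (x : 'Z_p) : (x \is a GRing.unit) = (x != 0).
Proof.
rewrite -{1}(natr_val_Zp x) unitZpE // prime_coprime //.
by congr (~~ _); rewrite -[in RHS](natr_val_Zp x) -val_eqE /= val_Zp_nat.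
Qed.

Lemma unit_Zp2 (y : 'Z_(p ^ 2)) : (y \is a GRing.unit) = (red y != 0).
Proof.
rewrite -{1}(natr_val_Zp y) unitZpE // coprime_pexpl // prime_coprime //.
by congr (~~ _); rewrite -val_eqE /= /red val_Zp_nat.
Qed.

Lemma mulZp_eq0 (x y : 'Z_p) : x != 0 -> (x * y == 0) = (y == 0).
Proof. by rewrite -unit_Zp => /unit_mulr_eq0. Qed.

(** Every fibre of [red] is a coset of the image of [lift], which has p elements; [g] adds a
    multiple of p to a chosen representative of the residue. *)
Lemma card_red (B : {set 'Z_p}) : #|[set y | red y \in B]| = (#|B| * p)%N.
Proof.
pose g (u : 'Z_p * 'Z_p) : 'Z_(p ^ 2) := (u.1 : nat)%:R + lift u.2.
have redg u : red (g u) = u.1.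
  by rewrite redD red_lift addr0 red_nat natr_val_Zp.
rewrite -[X in (_ * X)%N]card_Z_p -[X in (_ * X)%N]cardsT -cardsX.
rewrite -(card_imset (f := g)) => [|[b x] [c z] eq_g].
  apply: eq_card => y; rewrite inE; apply/idP/imsetP => [yB | [u uB ->]].
    exists (red y, unlift (y - (red y : nat)%:R)); rewrite ?inE ?yB //=.
    rewrite /g /= unliftK ?subrKC //.
    by rewrite redD redN red_nat natr_val_Zp subrr.
  by move: uB; rewrite redg inE => /andP[].
have /= eq_bc := congr1 red eq_g; rewrite !redg /= in eq_bc.
by move: eq_g; rewrite /g /= eq_bc => /addrI /(can_inj liftK) ->.
Qed.

(** * Endomorphisms and automorphisms as coefficient tuples *)

Definition coefs : finType := ('Z_p * ('Z_p * 'Z_p) * 'Z_(p ^ 2))%type.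

Definition endo (t : coefs) (u : 'Z_p * 'Z_(p ^ 2)) : 'Z_p * 'Z_(p ^ 2) :=
  let: (a, (b, c), d) := t in
  (a * u.1 + b * red u.2, lift (c * u.1) + d * u.2).

Definition coefs_of (f : 'Z_p * 'Z_(p ^ 2) -> 'Z_p * 'Z_(p ^ 2)) : coefs :=
  ((f (1, 0)).1, ((f (0, 1)).1, unlift (f (1, 0)).2), (f (0, 1)).2).

Lemma endoD t : {morph endo t : u v / u + v}.
Proof.
move: t => [[a [b c]] d] [x y] [x' y'].
congr pair; rewrite /= ?redD ?mulrDr ?liftD; ring.
Qed.

Lemma endoK t : coefs_of (endo t) = t.
Proof.
move: t => [[a [b c]] d]; rewrite /coefs_of /= red0 red1 !mulr0 !mulr1 lift0.
by rewrite !addr0 !add0r liftK.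
Qed.

(** An additive map is determined by its values at the generators (1, 0) and (0, 1). The first
    generator has order p, so the second coordinate of its image is a multiple of p and [unlift]
    loses nothing. *)
Lemma coefs_ofK f : {morph f : u v / u + v} -> f =1 endo (coefs_of f).
Proof.
move=> fD; have f0 : f 0 = 0 by apply: (addrI (f 0)); rewrite -fD !addr0.
have fMn u n : f (u *+ n) = f u *+ n.
  by elim: n => [|n IHn]; rewrite ?mulr0n ?f0 // !mulrS fD IHn.
have red_f10 : red (f (1, 0)).2 = 0.
  (* Since [lift (red y)] is p times y, it is enough that p kills the image of (1, 0), and p already
     kills (1, 0). *)
  apply: (can_inj liftK); rewrite lift0 -[red _]mul1r liftM.
  rewrite (lift_nat 1) muln1 mulr_natl -raddfMn -fMn.
  suff -> : ((1, 0) : 'Z_p * 'Z_(p ^ 2)) *+ p = 0 by rewrite f0.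
  by rewrite pairMnE /= mul0rn pchar_Zp.
move=> [x y].
have -> : (x, y) = (1, 0) *+ x + (0, 1) *+ y :> 'Z_p * 'Z_(p ^ 2).
  by rewrite !pairMnE /= !mul0rn; congr pair; rewrite ?addr0 ?add0r natr_val_Zp.
rewrite fD !fMn /endo /coefs_of.
case E1: (f (1, 0)) red_f10 => [a c'] /= red_c; case E2: (f (0, 1)) => [b d].
rewrite !pairMnE /= !mul0rn addr0 add0r !natr_val_Zp.
congr pair; rewrite /=.
  by rewrite -[a *+ _]mulr_natr -[b *+ _]mulr_natr natr_val_Zp.
rewrite -[c' *+ _]mulr_natr -[d *+ _]mulr_natr natr_val_Zp; congr (_ + _).
by rewrite -[x in RHS](natr_val_Zp x) -(red_nat x) liftM unliftK.
Qed.

(** On a kernel element, the second coordinate modulo p gives that p divides y, then the first gives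
    x = 0, then the second gives y = 0. Conversely, if p divides d then (0, p) is in the kernel; if
    d is a unit and a = 0, then (1, 0) and (0, p c / d) have the same image. *)
Lemma endo_inj t :
  reflect (injective (endo t)) ((t.1.1 != 0) && (red t.2 != 0)).
Proof.
move: t => [[a [b c]] d] /=; apply: (iffP andP) => [[a0 d0] | injE].
  move=> u v eq_uv; apply/eqP; rewrite -subr_eq0; apply/eqP.
  have : endo (a, (b, c), d) (u - v) = 0.
    by apply: (addIr (endo (a, (b, c), d) v)); rewrite -endoD subrK add0r.
  case: (u - v) => x y E; have /= Ex := congr1 fst E.
  have /= Ey := congr1 snd E.
  have ry : red y = 0.
    have /eqP := congr1 red Ey; rewrite redD red_lift add0r redM red0.
    by rewrite mulZp_eq0 // => /eqP.
  move/eqP: Ex; rewrite ry mulr0 addr0 mulZp_eq0 // => /eqP x0.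
  move/eqP: Ey; rewrite x0 mulr0 lift0 add0r unit_mulr_eq0 ?unit_Zp2 //.
  by move=> /eqP ->.
have oner0 : (1 : 'Z_p) != 0 by exact: oner_neq0.
have d0 : red d != 0.
  apply: contra_neq oner0 => d0; apply: (can_inj liftK); rewrite lift0.
  have /injE/(congr1 snd) // : endo (a, (b, c), d) (0, lift 1) =
                              endo (a, (b, c), d) (0, 0).
  rewrite /= red_lift red0 [d * lift _]mulrC -liftM d0.
  by rewrite !mulr0 lift0.
split=> //; apply: contra_neq oner0 => a0.
have /injE/(congr1 fst) // : endo (a, (b, c), d) (1, 0) =
                  endo (a, (b, c), d) (0, lift (c / red d)).
rewrite /= a0 red_lift red0 [d * lift _]mulrC -liftM divrK ?unit_Zp //.
by rewrite !mulr0 !mulr1 lift0 !addr0 add0r.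
Qed.

(** By finiteness an injective endomorphism is an automorphism, so [coefs_of] matches automorphisms
    with the tuples of injective [endo]. *)
Lemma card_Aut_fixed n :
  theta (Zp_oplus_Zp2 p) n =
  #|[set t : coefs | [&& t.1.1 != 0, red t.2 != 0 &
                         #|[set u | endo t u == u]| == n]]|.
Proof.
have AutP (f : {perm 'Z_p * 'Z_(p ^ 2)}) :
  f \in Aut (Zp_oplus_Zp2 p) <-> {morph f : u v / u + v}.
  split=> [/Aut_morphic/morphicP fM u v | fM].
    by apply: fM; rewrite inE.
  rewrite inE; apply/andP; split.
    by apply/subsetP => u; rewrite inE.
  by apply/morphicP => u v _ _; apply: fM.
have fixE (f : {perm 'Z_p * 'Z_(p ^ 2)}) t : f =1 endo t ->
    Omega (Zp_oplus_Zp2 p) f = [set u | endo t u == u].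
  by move=> ft; apply/setP => u; rewrite !inE ft.
rewrite /theta -(card_in_imset (f := fun f : {perm _} => coefs_of f));
  last first.
  move=> f g; rewrite inE => /andP[/AutP fM _].
  rewrite inE => /andP[/AutP gM _] eq_fg.
  by apply/permP => u; rewrite (coefs_ofK fM) (coefs_ofK gM) eq_fg.
apply: eq_card => t; rewrite [in RHS]inE.
apply/imsetP/and3P => [[f] | [a0 d0 nt]].
  rewrite inE => /andP[/AutP fM nf ->]; have fE := coefs_ofK fM.
  have /endo_inj/andP[-> ->] : injective (endo (coefs_of f)).
    by apply: eq_inj fE; apply: perm_inj.
  by rewrite -(fixE f).
have /endo_inj injt : (t.1.1 != 0) && (red t.2 != 0) by rewrite a0.
have ft : perm injt =1 endo t by apply: permE.
exists (perm injt).
  by rewrite inE (fixE _ _ ft) nt andbT; apply/AutP => u v; rewrite !ft endoD.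
by rewrite -[LHS]endoK /coefs_of !ft.
Qed.

(** * Fixed points of a given endomorphism *)

Lemma endo_fixE a b c d x y :
  (endo (a, (b, c), d) (x, y) == (x, y)) =
  ((a - 1) * x + b * red y == 0) && (lift (c * x) + (d - 1) * y == 0).
Proof.
rewrite /= xpair_eqE -(subr_eq0 _ x) -(subr_eq0 _ y).
by congr (_ && _); congr (_ == _); ring.
Qed.

(** Here d - 1 is a unit, so the second equation gives y in terms of x and makes it a multiple of p.
    The term in b then vanishes, leaving (a - 1) x = 0. *)
Lemma card_fixed_unit a b c d : red d != 1 ->
  #|[set u | endo (a, (b, c), d) u == u]| = if a == 1 then p else 1%N.
Proof.
rewrite -subr_eq0 -red1 -redN -redD -unit_Zp2 => d1.
pose g x : 'Z_p * 'Z_(p ^ 2) := (x, - (d - 1)^-1 * lift (c * x)).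
have -> : [set u | endo (a, (b, c), d) u == u] =
          [set g x | x in [set x | (a - 1) * x == 0]].
  apply/setP => -[x y]; rewrite inE endo_fixE.
  apply/andP/imsetP => [[xE yE] | [x' x'E [-> ->]]].
    have y0 : y = - (d - 1)^-1 * lift (c * x).
      apply: (mulrI d1); rewrite mulrA mulrN divrr // mulN1r.
      by apply/eqP; rewrite -addr_eq0 addrC.
    exists x; last by rewrite y0.
    by move: xE; rewrite y0 redM red_lift !mulr0 addr0 inE.
  rewrite redM red_lift !mulr0 addr0 mulrA mulrN divrr // mulN1r subrr eqxx.
  by rewrite inE in x'E.
rewrite card_imset => [|x x' [] //]; case: ifP => [/eqP-> | /negbT a1].
  by rewrite -[RHS]card_Z_p; apply: eq_card => x; rewrite inE subrr mul0r eqxx.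
rewrite -(cards1 (0 : 'Z_p)); apply: eq_card => x.
by rewrite !inE mulZp_eq0 // subr_eq0.
Qed.

(** For d = 1 + p e the second equation is p times a linear form in x and y, hence a condition
    modulo p only. *)
Lemma endo_fix_unipotentE a b c e x y :
  (endo (a, (b, c), 1 + lift e) (x, y) == (x, y)) =
  ((a - 1) * x + b * red y == 0) && (c * x + e * red y == 0).
Proof.
rewrite endo_fixE addrAC subrr add0r -liftM -liftD.
by rewrite -[in RHS](can_eq liftK (c * x + _)) lift0.
Qed.

(** The three cases are rank 0, 1 and 2 of the matrix [[a - 1, b], [c, e]] over Z/p, the last two
    told apart by the determinant. Lifting y from Z/p to Z/p^2 multiplies the size of the kernel by
    p. *)
Lemma card_fixed_unipotent a b c e :
  #|[set u | endo (a, (b, c), 1 + lift e) u == u]| =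
  if (a, (b, c), e) == (1, (0, 0), 0) then (p ^ 3)%N
  else if (a - 1) * e == b * c then (p ^ 2)%N else p.
Proof.
have cardp2 : #|'Z_(p ^ 2)| = (p ^ 2)%N by rewrite card_ord Zp_cast.
have card_ker : #|[set y : 'Z_(p ^ 2) | red y == 0]| = p.
  have := card_red [set 0]; rewrite cards1 mul1n; apply: etrans.
  by apply: eq_card => y; rewrite !inE.
have card_graph v :
    #|[set (v * red y, y) | y in [set: 'Z_(p ^ 2)]]| = (p ^ 2)%N.
  by rewrite card_imset => [|y y' []] //; rewrite cardsT.
case: ifP => [/eqP[-> -> -> ->] | /negbT triv].
  transitivity #|[set: 'Z_p * 'Z_(p ^ 2)]|.
    apply: eq_card => -[x y].
    by rewrite inE endo_fix_unipotentE subrr !mul0r addr0 eqxx inE.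
  by rewrite cardsT card_prod card_Z_p cardp2 -expnS.
case: ifP => [/eqP det | /negbT det]; last first.
  transitivity #|setX [set (0 : 'Z_p)] [set y : 'Z_(p ^ 2) | red y == 0]|.
    apply: eq_card => -[x y]; rewrite inE endo_fix_unipotentE !inE /=.
    apply/andP/andP => [[/eqP E1 /eqP E2] | [/eqP-> /eqP->]].
      rewrite -subr_eq0 in det; split; rewrite -(mulZp_eq0 _ det).
        (* Cramer's rule: combining the equations with the rows of the adjugate matrix isolates the
           determinant times x, and below times y. *)
        rewrite (_ : _ * x = e * ((a - 1) * x + b * red y)
                             - b * (c * x + e * red y)); last by ring.
        by rewrite E1 E2 !mulr0 subr0.
      rewrite (_ : _ * red y = (a - 1) * (c * x + e * red y)
                               - c * ((a - 1) * x + b * red y)); last by ring.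
      by rewrite E1 E2 !mulr0 subr0.
    by rewrite !mulr0 addr0 eqxx.
  by rewrite cardsX cards1 mul1n card_ker.
have [a1 | a1] := eqVneq a 1; last first.
  (* Rank one with a - 1 invertible: the first equation gives x, and the second is proportional to
     it. *)
  rewrite -subr_eq0 in a1; apply: etrans (card_graph (- b / (a - 1))).
  apply: eq_card => -[x y]; rewrite inE endo_fix_unipotentE.
  apply/andP/imsetP => [[/eqP E1 /eqP E2] | [y' _ [-> ->]]].
    exists y; rewrite ?in_setT //; congr pair; apply: (mulrI (x := a - 1)).
      by rewrite unit_Zp.
    by rewrite mulrA mulrCA divrr ?unit_Zp // mulr1 mulNr; apply/eqP;
      rewrite -addr_eq0 E1.
  split; first by rewrite mulrA mulrCA divrr ?unit_Zp // mulr1 mulNr addNr.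
  rewrite -(mulZp_eq0 _ a1).
  (* The quotient of a - 1 by itself stays uncancelled because [ring] treats the inverse as an
     opaque factor; [divrr] removes it afterwards. *)
  rewrite (_ : _ * _ = ((a - 1) * e - b * c * ((a - 1) / (a - 1))) * red y');
    last by ring.
  by rewrite divrr ?unit_Zp // mulr1 det subrr mul0r.
rewrite a1 subrr mul0r in det.
have [c0 | c0] := eqVneq c 0; last first.
  have b0 : b = 0 by apply/eqP; rewrite -(mulZp_eq0 _ c0) mulrC -det.
  apply: etrans (card_graph (- e / c)).
  apply: eq_card => -[x y]; rewrite inE endo_fix_unipotentE a1 b0.
  rewrite subrr !mul0r addr0 eqxx /=.
  apply/eqP/imsetP => [E2 | [y' _ [-> ->]]].
    exists y; rewrite ?in_setT //; congr pair; apply: (mulrI (x := c)).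
      by rewrite unit_Zp.
    by rewrite mulrA mulrCA divrr ?unit_Zp // mulr1 mulNr; apply/eqP;
      rewrite -addr_eq0 E2.
  by rewrite mulrA mulrCA divrr ?unit_Zp // mulr1 mulNr addNr.
(* The first column is zero, and b or e is not, so the system says that p divides y and leaves x
   free. *)
transitivity #|setX [set: 'Z_p] [set y : 'Z_(p ^ 2) | red y == 0]|.
  apply: eq_card => -[x y]; rewrite inE endo_fix_unipotentE !inE /=.
  rewrite a1 c0 subrr !mul0r !add0r.
  have [b0 | b0] := eqVneq b 0; last first.
    rewrite mulZp_eq0 //; case: eqP => // ->.
    by rewrite mulr0 eqxx.
  rewrite b0 mul0r eqxx mulZp_eq0 //.
  by apply: contra_neq triv => ->; rewrite a1 b0 c0.
by rewrite cardsX cardsT card_Z_p card_ker mulnn.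
Qed.

(* Only meaningful for [d = 1] modulo [p], where [unlift (d - 1)] is the [e]
   such that [d = 1 + p e]. *)
Definition degenerate (t : coefs) : bool :=
  let: (a, (b, c), d) := t in (a - 1) * unlift (d - 1) == b * c.

Lemma unipotentE d : red d = 1 -> d = 1 + lift (unlift (d - 1)).
Proof. by move=> d1; rewrite unliftK ?subrKC // redD redN red1 d1 subrr. Qed.

(** When d = 1 modulo p this is 3 minus the rank; the tuple singled out is that of the identity. In
    the last branch the boolean counts as 0 or 1. *)
Definition fixed_log (t : coefs) : nat :=
  if red t.2 == 1 then
    if t == (1, (0, 0), 1) then 3%N else if degenerate t then 2%N else 1%N
  else t.1.1 == 1.

Lemma card_fixed t : #|[set u | endo t u == u]| = (p ^ fixed_log t)%N.
Proof.
rewrite /fixed_log; case: t => [[a [b c]] d] /=.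
case: eqP => [d1 | /eqP d1]; last first.
  by rewrite card_fixed_unit //; case: eqP; rewrite ?expn1.
have dE : (d == 1) = (unlift (d - 1) == 0).
  rewrite -(can_eq liftK) lift0 unliftK ?subr_eq0 //.
  by rewrite redD redN red1 d1 subrr.
rewrite {1}(unipotentE d1) card_fixed_unipotent !xpair_eqE dE.
by case: (_ && _); [| case: (_ == _)]; rewrite ?expn1.
Qed.

(** * Counting the tuples with a given number of fixed points *)

Lemma thetaE k :
  theta (Zp_oplus_Zp2 p) (p ^ k) =
  #|[set t : coefs | [&& t.1.1 != 0, red t.2 != 0 & fixed_log t == k]]|.
Proof.
rewrite card_Aut_fixed; apply: eq_card => t.
by rewrite !inE card_fixed eqn_exp2l.
Qed.

(** Substituting q + 2 for p removes the truncated subtractions p - 1 and p - 2 before [lia]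
    compares polynomials. *)
Let p_eq2 : exists q, p = q.+2.
Proof. by case: p p_gt1 => [|[|q]] // _; exists q. Qed.

Lemma card_neq01 : #|~: [set (0 : 'Z_p); 1]| = (p - 2)%N.
Proof.
have := cardsC [set (0 : 'Z_p); 1].
by rewrite cards2 eq_sym oner_eq0 card_Z_p; lia.
Qed.

Lemma card_neq0 : #|~: [set (0 : 'Z_p)]| = (p - 1)%N.
Proof. by have := cardsC [set (0 : 'Z_p)]; rewrite cards1 card_Z_p; lia. Qed.

Lemma card_pairs : #|[set: 'Z_p * 'Z_p]| = (p * p)%N.
Proof. by rewrite cardsT card_prod card_Z_p. Qed.

(** The complement consists of the pairs of nonzero elements, and p^2 - (p - 1)^2 = 2 p - 1. *)
Lemma card_mul0 : #|[set u : 'Z_p * 'Z_p | u.1 * u.2 == 0]| = (2 * p - 1)%N.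
Proof.
have := cardsC (setX (~: [set (0 : 'Z_p)]) (~: [set (0 : 'Z_p)])).
rewrite cardsX card_neq0 card_prod card_Z_p.
rewrite (_ : ~: _ = [set u : 'Z_p * 'Z_p | u.1 * u.2 == 0]).
  by move: #|_| => m; have [q ->] := p_eq2; lia.
apply/setP => -[x y]; rewrite !inE /= negb_and !negbK.
by have [-> | x0] := eqVneq x 0; rewrite ?mul0r ?eqxx //= mulZp_eq0.
Qed.

(** If a = 1, the condition is b c = 0 and e is free, giving (2 p - 1) p tuples ([A1]). If a is
    neither 0 nor 1, then b and c are free and e = b c / (a - 1), giving (p - 2) p^2 tuples
    ([A2]). *)
Lemma card_degenerate :
  #|[set t : coefs | [&& t.1.1 != 0, red t.2 == 1 & degenerate t]]| =
  (p ^ 3 - p)%N.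
Proof.
pose A1 := setX (setX [set (1 : 'Z_p)] [set u : 'Z_p * 'Z_p | u.1 * u.2 == 0])
                [set d | red d \in [set 1]].
pose g (v : 'Z_p * ('Z_p * 'Z_p)) : coefs :=
  (v, 1 + lift (v.2.1 * v.2.2 / (v.1 - 1))).
pose A2 := [set g v | v in setX (~: [set 0; 1]) setT].
have -> : [set t : coefs | [&& t.1.1 != 0, red t.2 == 1 & degenerate t]]
          = A1 :|: A2.
  apply/setP => -[[a [b c]] d]; rewrite in_setU [in LHS]inE /=.
  apply/and3P/orP => [[a0 /eqP d1 /eqP det] | [|]]; last first.
  - case/imsetP => v vA [vE ->]; move: vA; rewrite -vE.
    rewrite !inE negb_or andbT => /andP[a0 a1].
    rewrite a0 redD red_lift addr0 red1 addrAC subrr add0r liftK mulrC.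
    by rewrite divrK ?unit_Zp ?subr_eq0.
  - rewrite !inE /= -andbA => /and3P[/eqP-> /eqP-> ->].
    by rewrite oner_neq0 subrr mul0r.
  have [a1 | a1] := eqVneq a 1.
    by left; rewrite !inE /= d1 a1 -det a1 subrr mul0r !eqxx.
  right; apply/imsetP; exists (a, (b, c)).
    by rewrite !inE /= negb_or a0 a1.
  rewrite /g /= -det mulrAC divrr ?unit_Zp ?subr_eq0 // mul1r.
  by rewrite -unipotentE.
rewrite cardsU (_ : A1 :&: A2 = set0) ?cards0 ?subn0; last first.
  apply/setP => t; rewrite in_set0; apply/negbTE/negP; rewrite in_setI.
  case/andP => tA1 /imsetP[v vA2 tE]; move: tA1 vA2; rewrite tE !inE /=.
  by case/andP => /andP[/eqP-> _] _; rewrite eqxx orbT.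
rewrite /A1 !cardsX card_red !cards1 card_mul0 card_imset; last first.
  by move=> v w [].
rewrite cardsX card_neq01 card_pairs.
by have [q ->] := p_eq2; lia.
Qed.

Lemma degenerate_id : degenerate (1, (0, 0), 1).
Proof. by rewrite /degenerate subrr !mul0r. Qed.

(** Exponent 0 occurs exactly when neither a nor d is 0 or 1 modulo p, with b and c free. *)
Lemma theta_1 :
  theta (Zp_oplus_Zp2 p) 1 = ((p - 2) * (p * p) * ((p - 2) * p))%N.
Proof.
rewrite (thetaE 0).
have -> : [set t : coefs | [&& t.1.1 != 0, red t.2 != 0 & fixed_log t == 0]] =
  setX (setX (~: [set 0; 1]) setT) [set d | red d \in ~: [set 0; 1]].
  apply/setP => t; rewrite !inE /fixed_log !negb_or andbT.
  case: (red t.2 =P 1) => [->|_]; first by do 2?case: ifP => //; rewrite !andbF.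
  by rewrite andbT eqb0 -!andbA; do !bool_congr.
by rewrite !cardsX card_red card_neq01 card_pairs.
Qed.

Lemma theta_p3 : theta (Zp_oplus_Zp2 p) (p ^ 3) = 1%N.
Proof.
rewrite thetaE -[RHS](cards1 ((1, (0, 0), 1) : coefs)).
apply: eq_card => t; rewrite !inE /fixed_log.
have [-> | nt] /= := eqVneq t (1, (0, 0), 1).
  by [].
by case: (red t.2 == 1); [case: degenerate | case: (t.1.1 == 1)];
  rewrite !andbF.
Qed.

(** Exponent 2 needs a degenerate tuple with d = 1 modulo p; the identity is one of these and has to
    be taken out. *)
Lemma theta_p2 : theta (Zp_oplus_Zp2 p) (p ^ 2) = (p ^ 3 - p - 1)%N.
Proof.
rewrite thetaE -card_degenerate.
rewrite -[X in (_ - X)%N](cards1 ((1, (0, 0), 1) : coefs)).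
rewrite -cardsDS; last first.
  by rewrite sub1set inE degenerate_id red1 eqxx oner_neq0.
apply: eq_card => t; rewrite !inE /fixed_log.
have [-> | nt] /= := eqVneq t (1, (0, 0), 1).
  by [].
case: (red t.2 =P 1) => [-> | _]; last first.
  by case: (t.1.1 == 1); rewrite !andbF.
by rewrite oner_neq0; case: ifP.
Qed.

(** Exponent 1 has two sources: a = 1 with d neither 0 nor 1 modulo p ([A1]), and d = 1 modulo p
    with nonzero determinant ([A2] without [D]). *)
Lemma theta_p : theta (Zp_oplus_Zp2 p) p =
   (p * p * ((p - 2) * p) + ((p - 1) * (p * p) * p - (p ^ 3 - p)))%N.
Proof.
rewrite -[X in theta _ X]expn1 thetaE.
pose A1 := setX (setX [set (1 : 'Z_p)] [set: 'Z_p * 'Z_p])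
                [set d | red d \in ~: [set 0; 1]].
pose A2 := setX (setX (~: [set (0 : 'Z_p)]) [set: 'Z_p * 'Z_p])
                [set d | red d \in [set 1]].
pose D := [set t : coefs | [&& t.1.1 != 0, red t.2 == 1 & degenerate t]].
have -> : [set t : coefs | [&& t.1.1 != 0, red t.2 != 0 & fixed_log t == 1]] =
    A1 :|: (A2 :\: D).
  apply/setP => t; rewrite !inE /fixed_log !andbT.
  have [-> | nt] := eqVneq t (1, (0, 0), 1).
    by rewrite degenerate_id red1.
  case: (red t.2 =P 1) => [-> | _].
    by rewrite oner_neq0 orbT andbF /=; case: ifP; case: (_ == 0).
  rewrite !andbF !orbF.
  have [-> | _] := eqVneq t.1.1 1; last by rewrite !andbF.
  by rewrite oner_neq0 andbT.
rewrite cardsU (_ : A1 :&: _ = set0) ?cards0 ?subn0; last first.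
  apply/setP => t; rewrite !inE; case: (red t.2 == 1); by rewrite ?orbT ?andbF.
rewrite cardsDS; last first.
  by apply/subsetP => t; rewrite !inE => /and3P[-> -> _].
by rewrite card_degenerate !cardsX !card_red !cards1 card_neq01 card_neq0
  card_pairs !mul1n.
Qed.

End ReductionModP.

Theorem theorem3p10 (p : nat) (p_pr : prime p) :
  [/\ (theta (Zp_oplus_Zp2 p) 1)%:Z = p%:Z ^+ 3 * (p%:Z - 2) ^+ 2,
      (theta (Zp_oplus_Zp2 p) p)%:Z
        = p%:Z * (2 * p%:Z ^+ 3 - 4 * p%:Z ^+ 2 + 1),
      (theta (Zp_oplus_Zp2 p) (p ^ 2))%:Z = p%:Z ^+ 3 - p%:Z - 1
    & (theta (Zp_oplus_Zp2 p) (p ^ 3))%:Z = 1].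
Proof.
rewrite theta_1 // theta_p // theta_p2 // theta_p3 //.
(* The counts use truncated subtraction; for p at least 2 it agrees with subtraction of integers. *)
case: p {p_pr} (prime_gt1 p_pr) => [|[|q]] // _.
split=> //; lia.
Qed.
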